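(* Let $\mathcal X$ be an ordered topological vector space. Assume $\mathcal A\subset\mathcal X$ is a coherent acceptance set and let $S=(S_0,S_T)$ be a traded asset. (i) The following statements are equivalent: (a) $\rho_{\mathcal A,S}$ is finitely valued; (b) $S_T\in\operatorname{core}(\mathcal A)$. (ii) The following statements are equivalent: (a) $\rho_{\mathcal A,S}$ is continuous on $\mathcal X$; (b) $\rho_{\mathcal A,S}$ is continuous at $0$; (c) $S_T\in\operatorname{int}(\mathcal A)$. Moreover, if $\mathcal X$ is an ordered normed space, then $\rho_{\mathcal A,S}$ is Lipschitz continuous whenever $S_T\in\operatorname{int}(\mathcal A)$.
   Context: An ordered topological vector space $\mathcal X$ is a Hausdorff real topological vector space ordered by a pointed convex cone $\mathcal X_+$ (a cone is a set closed under multiplication by every $\lambda\ge0$; pointed means $\mathcal X_+\cap(-\mathcal X_+)=\{0\}$); $X\le Y$ means $Y-X\in\mathcal X_+$. It is an ordered normed space if its topology is given by a norm. For $\mathcal B\subset\mathcal X$, $\operatorname{int}(\mathcal B)$ is the interior and $\operatorname{core}(\mathcal B)$ is the set of $X\in\mathcal B$ such that for each $Y\in\mathcal X$ there is $\varepsilon>0$ with $X+\lambda Y\in\mathcal B$ whenever $|\lambda|<\varepsilon$. An acceptance set is a nonempty proper subset $\mathcal A\subset\mathcal X$ such that $X\in\mathcal A$ and $Y\ge X$ imply $Y\in\mathcal A$; it is coherent if it is a convex cone. A traded asset is a pair $S=(S_0,S_T)$ with $S_0>0$ a real number and $S_T\in\mathcal X_+$ nonzero. The associated risk measure $\rho_{\mathcal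 A,S}:\mathcal X\to\mathbb R\cup\{\pm\infty\}$ is $$\rho_{\mathcal A,S}(X)=\inf\{m\in\mathbb R : X+\tfrac{m}{S_0}S_T\in\mathcal A\},$$ with $\inf\emptyset=\infty$. A function $\rho:\mathcal X\to\mathbb R\cup\{\pm\infty\}$ is lower semicontinuous at $X$ if for every $\varepsilon>0$ there is a neighborhood $\mathcal U$ of $X$ with $\rho(Y)\ge\rho(X)-\varepsilon$ for all $Y\in\mathcal U$, upper semicontinuous at $X$ if $-\rho$ is lower semicontinuous at $X$, and continuous at $X$ if both hold. *)

(* Defs.v *)
From HB Require Import structures.
From mathcomp Require Import all_boot all_order all_algebra.
From mathcomp Require Import all_classical all_reals all_analysis.

Set Implicit Arguments.
Unset Strict Implicit.
Unset Printing Implicit Defensive.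

Import Order.TTheory GRing.Theory Num.Theory.
Import numFieldNormedType.Exports.

Local Open Scope classical_set_scope.
Local Open Scope ring_scope.

Definition cone (R : realType) (X : lmodType R) (C : set X) : Prop :=
  forall (l : R) (x : X), 0 <= l -> C x -> C (l *: x).

Definition convex_cone (R : realType) (X : lmodType R) (C : set X) : Prop :=
  cone C /\ convex_set C.

(* A vector order is represented by its positive cone [P]. *)
Definition order_cone (R : realType) (X : lmodType R) (P : set X) : Prop :=
  convex_cone P /\ P `&` [set - x | x in P] = [set 0].

Definition cone_le (R : realType) (X : lmodType R) (P : set X) (x y : X) : Prop :=
  P (y - x).

(* [topologicalLmodType] is an arbitrary topological vector space, whereas
   [tvsType] would add local convexity. *)
Definition ordered_tvs (R : realType) (X : topologicalLmodType R) (P : set X) : Prop :=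
  hausdorff_space X /\ order_cone P.

Definition core (R : realType) (X : lmodType R) (B : set X) : set X :=
  [set x | B x /\
    forall y : X, exists2 e : R, 0 < e &
      forall l : R, `|l| < e -> B (x + l *: y)].

Definition acceptance_set (R : realType) (X : lmodType R) (P A : set X) : Prop :=
  [/\ A !=set0, A <> setT & forall x y : X, A x -> cone_le P x y -> A y].

Definition coherent_acceptance_set (R : realType) (X : lmodType R)
    (P A : set X) : Prop :=
  acceptance_set P A /\ convex_cone A.

Record traded_asset (R : realType) (X : lmodType R) (P : set X) := TradedAsset {
  price : R;
  payoff : X;
  price_gt0 : 0 < price;
  payoff_ge0 : P payoff;
  payoff_neq0 : payoff <> 0 }.

Definition risk_measure (R : realType) (X : lmodType R) (P A : set X)
    (S : traded_asset P) (x : X) : \bar R :=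
  ereal_inf [set m%:E | m in [set m : R | A (x + (m / price S) *: payoff S)]].

Definition finitely_valued (R : realType) (T : Type) (f : T -> \bar R) : Prop :=
  forall x, f x \is a fin_num.

(* Infinite values follow the arithmetic of [\bar R]: lower semicontinuity at a
   point where [f] is [+oo] requires [f] to be [+oo] on a neighborhood.  This is
   stronger there than the library's [lower_semicontinuous]. *)
Definition lsc_at (R : realType) (T : topologicalType) (f : T -> \bar R)
    (x : T) : Prop :=
  forall e : R, 0 < e -> \forall y \near x, (f x - e%:E <= f y)%E.

Definition usc_at (R : realType) (T : topologicalType) (f : T -> \bar R)
    (x : T) : Prop :=
  lsc_at (fun y => - f y)%E x.

Definition econtinuous_at (R : realType) (T : topologicalType) (f : T -> \bar R)
    (x : T) : Prop :=
  lsc_at f x /\ usc_at f x.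

(* [fine] sends infinite values to [0], hence the explicit finiteness. *)
Definition elipschitz (R : realType) (X : normedModType R)
    (f : X -> \bar R) : Prop :=
  finitely_valued f /\ lipschitz (fun x : X => fine (f x) : R^o).

(* Main.v *)
Require Import Defs.
From HB Require Import structures.
From mathcomp Require Import all_boot all_order all_algebra.
From mathcomp Require Import all_classical all_reals all_analysis.
From mathcomp Require Import lra.
Import Order.TTheory GRing.Theory Num.Theory.
Import numFieldNormedType.Exports.
Local Open Scope classical_set_scope.
Local Open Scope ring_scope.

(** The risk measure satisfies [rho y <= rho x + e] as soon as
    [y - x + (e / S_0) S_T] is acceptable, because the acceptance set is closed
    under addition.  If [S_T] is interior, this holds for all [y] close to [x],
    in both directions, hence continuity; in a normed space [e] can be taken
    proportional to [`|x - y|].  If [S_T] is only in the core, every [x] becomes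
    acceptable after adding a multiple of [S_T], and [rho x = -oo] would make
    [- S_T], and then every position, acceptable.  Conversely, upper
    semicontinuity at [0] makes [y + c S_T] acceptable for one [c > 0] and all
    [y] close to [0], hence [S_T] interior after rescaling. *)

(** The sum is twice the midpoint, which convexity places in [A]. *)
Lemma cone_convex_add (R : realType) (X : lmodType R) (A : set X) (x y : X) :
  convex_cone A -> A x -> A y -> A (x + y).
Proof.
move=> [cA vA] Ax Ay.
have h0 : 0 <= 2^-1 :> R by lra.
have h1 : 2^-1 <= 1 :> R by lra.
have := vA x y (Itv01 h0 h1); rewrite !inE => /(_ Ax Ay).
move=> /(cA 2 _ (ler0n R 2)); rewrite /conv/= scalerDr !scalerA /unstable.onem.
have -> : 1 - 2^-1 = 2^-1 :> R by lra.
by rewrite mulfV ?pnatr_eq0// !scale1r.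
Qed.

(** * Finiteness and the core, without topology *)

Section CoherentAcceptance.
Context {R : realType} {X : lmodType R} {P A : set X} {S : traded_asset P}.
Hypothesis coA : coherent_acceptance_set P A.

Let S0 := price S.
Let ST := payoff S.
Let rho := risk_measure A S.

Lemma acceptD x y : A x -> A y -> A (x + y).
Proof. by move: coA => [_ cA]; exact: cone_convex_add. Qed.

Lemma acceptZ (l : R) x : 0 <= l -> A x -> A (l *: x).
Proof. by move: coA => [_ [cA _]]; exact: cA. Qed.

Lemma accept0 : A 0.
Proof.
move: coA => [[[a Aa] _ _] _].
by rewrite -(scale0r a); exact: acceptZ.
Qed.

Lemma accept_payoff : A ST.
Proof.
move: coA => [[_ _ mA] _]; apply: (mA 0); first exact: accept0.
by rewrite /cone_le subr0; exact: payoff_ge0.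
Qed.

Lemma accept_payoff_le (a b : R) x :
  a <= b -> A (x + a *: ST) -> A (x + b *: ST).
Proof.
move=> ab Aa; rewrite -(subrKC a b) scalerDl addrA; apply: acceptD => //.
by apply: acceptZ accept_payoff; rewrite subr_ge0.
Qed.

Lemma risk_measure_le x (m : R) : A (x + (m / S0) *: ST) -> (rho x <= m%:E)%E.
Proof. by move=> Am; apply: ereal_inf_lbound; exists m. Qed.

(** The infimum need not be attained; strictness yields an admissible [n < m], which is then raised
    to [m]. *)
Lemma risk_measure_lt x (m : R) : (rho x < m%:E)%E -> A (x + (m / S0) *: ST).
Proof.
move=> /ereal_inf_lt[_ [n /= An <-]]; rewrite lte_fin => nm.
apply: accept_payoff_le An.
by rewrite ler_wpM2r ?invr_ge0 ?ltW// price_gt0.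
Qed.

Lemma risk_measure_leD x y (e : R) :
  A (y - x + (e / S0) *: ST) -> (rho y <= rho x + e%:E)%E.
Proof.
move=> Ae; rewrite -leeBlDr//; apply/ereal_infP => _ [m Am <-].
rewrite leeBlDr// -EFinD; apply: risk_measure_le.
have := acceptD _ _ Am Ae.
by rewrite addrACA (addrC x) subrK -scalerDl -mulrDl.
Qed.

Lemma finitely_valued_core : finitely_valued rho -> core A ST.
Proof.
move=> frho; split=> [|y]; first exact: accept_payoff.
have shift z : exists2 c : R, 0 < c & A (z + c *: ST).
  have /fin_numP[_ rz] := frho z.
  have {rz} : (rho z < +oo)%E by rewrite lt_neqAle rz leey.
  move=> /ereal_inf_lt[_ [m /= Am <-]] _.
  (* The maximum with [1] makes the multiple positive, so that its inverse can serve as a radius. *)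
  exists (Num.max 1 (m / S0)); first by rewrite lt_max ltr01.
  by apply: accept_payoff_le Am; rewrite le_max lexx orbT.
have [c c0 Ac] := shift y; have [d d0 Ad] := shift (- y).
(* Scaling by [l] gives [l *: z + (l * k) *: ST]; since [l * k <= 1], the coefficient of [ST] can be
   raised to [1]. Negative [l] is treated through [- y]. *)
have rescale (l k : R) z : 0 < k -> A (z + k *: ST) -> 0 <= l -> l < k^-1 ->
    A (ST + l *: z).
  move=> k0 Ak l0 lk; rewrite addrC -[ST]scale1r.
  apply: (@accept_payoff_le (l * k)).
    by rewrite -ler_pdivlMr// div1r ltW.
  by rewrite -scalerA -scalerDr; exact: acceptZ.
exists (Num.min c^-1 d^-1) => [|l]; first by rewrite lt_min !invr_gt0 c0.
rewrite lt_min => /andP[lc ld].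
have [l0|/ltW l0] := leP 0 l.
  by apply: (rescale _ c) => //; rewrite -(ger0_norm l0).
by rewrite -[l]opprK scaleNr -scalerN; apply: (rescale _ d) => //;
  rewrite -?(ler0_norm l0).
Qed.

Lemma core_finitely_valued : core A ST -> finitely_valued rho.
Proof.
move=> [_ cS] x; have S0_gt0 : 0 < S0 := price_gt0 S.
have shift z : exists c : R, A (z + c *: ST).
  have [e e0 Ae] := cS z; have e20 : 0 < e / 2 by lra.
  have : A (ST + (e / 2) *: z) by apply: Ae; rewrite gtr0_norm//; lra.
  move=> /(acceptZ (e / 2)^-1); rewrite invr_ge0 ltW// => /(_ isT).
  rewrite scalerDr scalerA mulVf ?gt_eqF// scale1r addrC => ?.
  by exists (e / 2)^-1.
rewrite fin_numE; apply/andP; split; last first.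
  have [c Ac] := shift x.
  rewrite lt_eqF//; apply: (@le_lt_trans _ _ (c * S0)%:E); last exact: ltry.
  by apply: risk_measure_le; rewrite mulfK ?gt_eqF.
apply/eqP => rx.
have [c Ac] := shift (- x).
(* Added to the acceptable [- x + c *: ST], the coefficient [- c - 1] leaves exactly [- ST]. *)
have /risk_measure_lt : (rho x < ((- c - 1) * S0)%:E)%E by rewrite rx ltNyr.
rewrite mulfK ?gt_eqF// => /(acceptD _ _ Ac).
rewrite addrACA addNr add0r -scalerDl addrA subrr add0r scaleN1r => ANS.
move: coA => [[_ AT _] _]; apply: AT; apply/seteqP; split => // z _.
have [d Ad] := shift z.
(* The coefficient must be at least [d] to make [z] acceptable, and nonnegative so that the same
   multiple of [- ST] is acceptable; the two sum to [z]. *)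
have := accept_payoff_le d (Num.max 0 d) z.
rewrite le_max lexx orbT => /(_ isT Ad).
move=> /acceptD /(_ (acceptZ (Num.max 0 d) _ _ ANS)).
by rewrite scalerN addrK; apply; rewrite le_max lexx.
Qed.

End CoherentAcceptance.

(** * Continuity and the interior *)

Lemma cvg_translate_scale (R : realType) (X : topologicalLmodType R) (T : Type)
    (F : set_system T) (f : T -> R^o) (g : T -> X) (a : R^o) (b z : X) :
  Filter F -> f @ F --> a -> g @ F --> b ->
  (fun t => z + f t *: g t) @ F --> z + a *: b.
Proof.
move=> FF fa gb; apply: continuous2_cvg.
- exact: (add_continuous (z, a *: b)).
- exact: cvg_cst.
- by apply: continuous2_cvg => //; exact: (scale_continuous (a, b)).
Qed.

(** The map [y |-> z + k *: (y - x)] is continuous and sends [x] to [z]. *)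
Lemma near_translate_scale (R : realType) (X : topologicalLmodType R)
    (B : set X) (x z : X) (k : R) :
  interior B z -> \forall y \near x, B (z + k *: (y - x)).
Proof.
rewrite /interior => Bz.
have : (fun y => z + k *: (y - x)) @ x --> z + k *: (x - x).
  apply: cvg_translate_scale; first exact: cvg_cst.
  apply: continuous2_cvg; last exact: cvg_cst; last exact: cvg_id.
  exact: (add_continuous (x, - x)).
by rewrite subrr scaler0 addr0; exact.
Qed.

Lemma interior_core (R : realType) (X : topologicalLmodType R) (B : set X) :
  interior B `<=` core B.
Proof.
move=> x Bx; split=> [|y]; first exact: interior_subset.
have : (fun l : R^o => x + l *: y) @ (0 : R^o) --> x + (0 : R^o) *: y.
  by apply: cvg_translate_scale; [exact: cvg_id|exact: cvg_cst].
rewrite scale0r addr0 => /(_ _ Bx) /nbhs_ballP[e /= e0 eB].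
exists e => // l le; apply: eB.
by rewrite -ball_normE /= sub0r normrN.
Qed.

Section TopologicalAcceptance.
Context {R : realType} {X : topologicalLmodType R} {P A : set X}
  {S : traded_asset P}.
Hypothesis coA : coherent_acceptance_set P A.

Lemma interior_econtinuous (x : X) :
  interior A (payoff S) -> econtinuous_at (risk_measure A S) x.
Proof.
move=> iS.
have rescale (e : R) z : 0 < e -> A (payoff S + (price S / e) *: z) ->
    A (z + (e / price S) *: payoff S).
  move=> e0 Az; have S0 := price_gt0 S.
  have e'0 : 0 < e / price S by exact: divr_gt0.
  have := acceptZ coA _ _ (ltW e'0) Az.
  rewrite scalerDr scalerA -[price S / e]invf_div mulfV ?gt_eqF//.
  by rewrite scale1r addrC.
split=> e e0.
(* The negative factor turns [y - x] into [x - y], which bounds [rho x] by [rho y + e]; the positive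
   factor below gives the reverse bound. *)
- apply: filterS (near_translate_scale _ _ _ x _ (- (price S / e)) iS) => y Ay.
  rewrite leeBlDr//; apply: (risk_measure_leD coA); apply: rescale => //.
  by rewrite -opprB scalerN -scaleNr.
- apply: filterS (near_translate_scale _ _ _ x _ (price S / e) iS) => y Ay.
  rewrite leeBlDr// leeNl fin_num_oppeD// oppeK.
  by rewrite leeBlDr//; apply: (risk_measure_leD coA); exact: rescale.
Qed.

Lemma usc_at0_interior :
  usc_at (risk_measure A S) 0 -> interior A (payoff S).
Proof.
move=> /(_ 1 ltr01) usc0; have S0 := price_gt0 S.
(* Upper semicontinuity with tolerance [1] gives [rho y <= 1] near [0]; the value [2] makes the
   inequality strict, as [risk_measure_lt] requires. *)
set c := 2 / price S; have c0 : 0 < c by rewrite divr_gt0.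
have rho0 : (risk_measure A S 0 <= 0)%E.
  apply: risk_measure_le; rewrite mul0r scale0r addr0; exact: accept0 coA.
have iB : interior [set y | A (y + c *: payoff S)] 0.
  apply: filterS usc0 => y /= rhoy; apply: (risk_measure_lt coA).
  apply: (@le_lt_trans _ _ 1%E); last by rewrite lte_fin ltr1n.
  rewrite -leeN2; apply: le_trans rhoy.
  by rewrite -[leLHS]add0e leeD2r// leeNr oppe0.
(* For [y] near the payoff, [c *: (y - payoff S)] is near [0]; adding [c *: payoff S] leaves
   [c *: y] acceptable. *)
have := near_translate_scale _ _ _ (payoff S) _ c iB.
apply: filterS => y /=; rewrite add0r -scalerDr subrK => Acy.
rewrite -[y]scale1r -(mulVf (lt0r_neq0 c0)) -scalerA.
by apply: (acceptZ coA) => //; rewrite invr_ge0 ltW.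
Qed.

End TopologicalAcceptance.

Lemma interior_elipschitz (R : realType) (X : normedModType R) (P A : set X)
    (S : traded_asset P) :
  coherent_acceptance_set P A -> interior A (payoff S) ->
  elipschitz (risk_measure A S).
Proof.
move=> coA iS; have S0 := price_gt0 S.
have frho := core_finitely_valued coA (interior_core _ _ _ _ iS); split=> //.
move: iS; rewrite /interior => /nbhs_ballP[r /= r0 rA].
pose k := 2 / r; have k0 : 0 < k by rewrite divr_gt0.
have Ak z : A (z + (k * `|z|) *: payoff S).
  have [->|z0] := eqVneq z 0.
    by rewrite normr0 mulr0 scale0r addr0; exact: accept0 coA.
  have kz0 : 0 < k * `|z| by rewrite mulr_gt0// normr_gt0.
  set c := k * `|z| in kz0 *.
  have -> : z + c *: payoff S = c *: (c^-1 *: z + payoff S).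
    by rewrite scalerDr scalerA mulfV ?lt0r_neq0// scale1r.
  apply: (acceptZ coA); first exact: ltW.
  apply: rA; rewrite -ball_normE /= opprD addrC subrK normrN normrZ.
  rewrite ger0_norm ?invr_ge0 ?(ltW kz0)// invfM -mulrA mulVf ?normr_eq0//.
  by rewrite mulr1 invf_div ltr_pdivrMr// mulr_natr mulr2n ltrDl.
have lip x y : fine (risk_measure A S y) - fine (risk_measure A S x)
    <= price S * k * `|x - y|.
  rewrite lerBlDl -lee_fin EFinD !fineK//.
  apply: (risk_measure_leD coA).
  by rewrite -[price S * _ * _]mulrA mulrC mulKf ?gt_eqF// distrC; exact: Ak.
apply: (@klipschitzW _ _ _ (price S * k)).
  exact: (@globally_properfilter _ _ (0, 0)).
move=> [x y] _; apply/ler_normlP; split; last by rewrite /= distrC; exact: lip.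
by rewrite /= opprB; exact: lip.
Qed.

Theorem theorem3p16 (R : realType) :
  (forall (X : topologicalLmodType R) (P A : set X) (S : traded_asset P),
     ordered_tvs P -> coherent_acceptance_set P A ->
     (finitely_valued (risk_measure A S) <-> core A (payoff S)) /\
     [<-> (forall x : X, econtinuous_at (risk_measure A S) x);
          econtinuous_at (risk_measure A S) 0;
          interior A (payoff S)]) /\
  (forall (X : normedModType R) (P A : set X) (S : traded_asset P),
     order_cone P -> coherent_acceptance_set P A ->
     interior A (payoff S) -> elipschitz (risk_measure A S)).
Proof.
split=> [X P A S _ coA|X P A S _]; last exact: interior_elipschitz.
split; first by split; [exact: finitely_valued_core|exact: core_finitely_valued].
tfae.
- by move=> /(_ 0).
- by move=> [_]; exact: usc_at0_interior.
- by move=> iS x; exact: interior_econtinuous.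
Qed.
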